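(* There exists a quiver Brascamp--Lieb datum $(\mathcal{Q},\mathbf{p})$ for which $$\mathrm{BLCD}_{\mathrm{G}}(\mathcal{Q},\mathbf{p}) < \mathrm{BLCD}(\mathcal{Q},\mathbf{p}) = \infty.$$
   Context: A quiver is a directed multigraph, here with finitely many vertices and arrows. It is bipartite if its vertex set is a disjoint union of two sets such that every arrow has its source in the first set and its target in the second. A quiver Brascamp--Lieb datum $(\mathcal{Q},\mathbf{p})$ consists of a bipartite quiver $\mathcal{Q}$ represented by nontrivial (i.e. nonzero) finite-dimensional real Hilbert spaces $H_1,\dots,H_n$ at the source vertices and $H^1,\dots,H^m$ at the target vertices, together with a surjective linear map $B_a : H_i \to H^j$ for each arrow $a \in \mathcal{A}_{ij}$, where $\mathcal{A}_{ij}$ is the finite set of arrows from $H_i$ to $H^j$ (distinct arrows may carry equal maps, and distinct vertices equal spaces), and of exponents $\mathbf{p} = (p_1,\dots,p_m)$ with $p_j \in [1,\infty]$. Let $\alpha_j := \sum_{i=1}^n \#(\mathcal{A}_{ij})$ be the number of arrows with target $H^j$. Each Hilbert space carries the Lebesgue measure induced by its inner product. Consider the inequality $$\prod_{i=1}^n \int_{H_i} \prod_{j=1}^m \prod_{a \in \mathcal{A}_{ij}} f_j(B_a x)\, dx \;\le\; C \prod_{j=1}^m \|f_j\|_{L^{p_j}(H^j)}^{\alpha_j}. \qquad ( * )$$ $\mathrm{BLCD}(\mathcal{Q},\mathbf{p}) \in [0,\infty]$ denotes the smallest constant $C \in [0,\infty]$ for which $( * )$ holds for all measurable functions $f_j :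 H^j \to [0,\infty]$, $1 \le j \le m$. $\mathrm{BLCD}_{\mathrm{G}}(\mathcal{Q},\mathbf{p}) \in [0,\infty]$ denotes the smallest constant $C \in [0,\infty]$ for which $( * )$ holds for all Gaussians of the form $f_j(x) = e^{-\pi \langle A_j x, x\rangle \alpha_j p_j^{-1}}$, $1 \le j \le m$, where $A_j$ ranges over all (symmetric) positive definite linear operators on $H^j$. Conventions: $1/\infty = 0$ and $0\cdot\infty = 0$; empty products, and zeroth powers, equal $1$. *)

(* Defs.v *)
From HB Require Import structures.
From mathcomp Require Import all_boot all_order all_algebra.
From mathcomp Require Import all_classical all_reals all_analysis.
From mathcomp Require Import measurable_realfun sesquilinear zify.

Set Implicit Arguments.
Unset Strict Implicit.
Unset Printing Implicit Defensive.

Import Order.TTheory GRing.Theory Num.Theory.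
Import numFieldNormedType.Exports.

Local Open Scope classical_set_scope.
Local Open Scope ring_scope.
Local Open Scope ereal_scope.

(* Product of the Lebesgue measure on R with a measure on R^d, transported to
   R^(d+1) along (x, t) |-> x :: t. *)
Section lebesgue_cons.
Context (R : realType) (d : nat).
Variable mu : {sigma_finite_measure set (d.-tuple (measurableTypeR R)) -> \bar R}.

Definition cons_fun (z : measurableTypeR R * d.-tuple (measurableTypeR R)) :
  d.+1.-tuple (measurableTypeR R) := [tuple of z.1 :: z.2].

Fact measurable_cons_fun : measurable_fun [set: _] cons_fun.
Proof. exact: measurable_cons. Qed.

Definition lebesgue_cons : set (d.+1.-tuple (measurableTypeR R)) -> \bar R :=
  pushforward (@lebesgue_measure R \x mu) cons_fun.

Fact lebesgue_cons0 : lebesgue_cons set0 = 0.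
Proof. by rewrite /lebesgue_cons /pushforward preimage_set0 measure0. Qed.

Fact lebesgue_cons_ge0 A : 0 <= lebesgue_cons A.
Proof. by rewrite /lebesgue_cons /pushforward measure_ge0. Qed.

Fact lebesgue_cons_sigma_additive : semi_sigma_additive lebesgue_cons.
Proof.
exact: (@measure_semi_sigma_additive _ _ _
  (measure_function_pushforward__canonical__measure_function_Measure
     (@lebesgue_measure R \x mu) measurable_cons_fun)).
Qed.

HB.instance Definition _ := isMeasure.Build _ _ _ lebesgue_cons
  lebesgue_cons0 lebesgue_cons_ge0 lebesgue_cons_sigma_additive.

Fact lebesgue_cons_sigma_finite : sigma_finite setT lebesgue_cons.
Proof.
have /sigma_finiteP[F [FT Fnd Foo]] := sigma_finiteT (@lebesgue_measure R).
have /sigma_finiteP[G [GT Gnd Goo]] := sigma_finiteT mu.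
pose tl (t : d.+1.-tuple (measurableTypeR R)) : d.-tuple (measurableTypeR R) :=
  [tuple of behead t].
exists (fun n => (@thead _ _) @^-1` F n `&` tl @^-1` G n).
  apply/seteqP; split => // t _.
  have [k _ Fk] : (\bigcup_k F k) (thead t) by rewrite -FT.
  have [l _ Gl] : (\bigcup_l G l) (tl t) by rewrite -GT.
  exists (maxn k l) => //; split.
    by rewrite /=; move: (thead t) Fk; exact/subsetPset/Fnd/leq_maxl.
  by rewrite /=; move: (tl t) Gl; exact/subsetPset/Gnd/leq_maxr.
move=> n; have [mF Fn] := Foo n; have [mG Gn] := Goo n; split.
  by apply: measurableI; rewrite -[X in measurable X]setTI;
    [exact: measurable_tnth|exact: measurable_behead].
rewrite /lebesgue_cons /pushforward (_ : _ @^-1` _ = F n `*` G n).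
  by rewrite product_measure1E// lte_mul_pinfty// ge0_fin_numE.
have consK z : tl (cons_fun z) = z.2 by exact: val_inj.
by apply/seteqP; split => -[x t]; rewrite /= consK.
Qed.

HB.instance Definition _ := Measure_isSigmaFinite.Build _ _ _ lebesgue_cons
  lebesgue_cons_sigma_finite.

End lebesgue_cons.

Fixpoint lebesgue_tuple (R : realType) (d : nat) :
    {sigma_finite_measure set (d.-tuple (measurableTypeR R)) -> \bar R} :=
  if d is d'.+1 then lebesgue_cons (lebesgue_tuple R d') else \d_[tuple].

(* Finite-dimensional real Hilbert space. {dot V for idfun} is the type of
   symmetric positive definite bilinear forms on V. *)
Record fdHilbert (R : realType) := FdHilbert {
  hspace :> vectType R;
  hdot : {dot hspace for idfun}
}.

Section fdHilbert_theory.
Context (R : realType) (H : fdHilbert R).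
Local Open Scope ring_scope.
Local Notation "<[ u , v ]>" := (hdot H u v).

Lemma orthonormal_extend (s : seq H) :
    free s && orthonormal (hdot H) s -> (size s < \dim {:H})%N ->
  exists v, free (v :: s) && orthonormal (hdot H) (v :: s).
Proof.
move=> /andP[frs /andP[s1 sO]] ltsH.
pose phi (u : H) : 'rV[R]_(size s) := \row_i <[u, s`_i]>.
have phiL : linear phi.
  by move=> a u v; apply/rowP => i; rewrite !mxE linearPl.
pose phiM := GRing.isLinear.Build _ _ _ _ phi phiL.
pose phi' : {linear H -> 'rV[R]_(size s)} := HB.pack phi phiM.
pose K := lker (linfun phi').
have K0 : K != 0%VS.
  rewrite -dimv_eq0 -lt0n; have := limg_ker_dim (linfun phi') fullv.
  rewrite capfv -/K => dimK.
  have : (\dim (limg (linfun phi')) <= size s)%N.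
    by rewrite (leq_trans (dimvS (subvf _)))// dimvf /dim/= mul1n.
  by move: ltsH; rewrite -dimK; lia.
pose w := vpick K.
have w0 : w != 0 by rewrite vpick0.
have wO u : u \in s -> <[w, u]> = 0.
  move=> us; have : w \in K by exact: memv_pick.
  rewrite memv_ker lfunE/= => /eqP/rowP.
  have is_ : (index u s < size s)%N by rewrite index_mem.
  by move=> /(_ (Ordinal is_)); rewrite !mxE/= nth_index.
have ww : 0 < <[w, w]> by exact: neq0_dnorm_gt0.
pose c := (Num.sqrt <[w, w]>)^-1.
have c0 : c != 0 by rewrite invr_eq0 sqrtr_eq0 -ltNge.
exists (c *: w); apply/andP; split.
  rewrite free_cons frs andbT; apply/negP => cws.
  have ws : w \in span s by rewrite -(scalerK c0 w) memvZ.
  have := ww; rewrite {2}(coord_span (X := in_tuple s) ws) linear_sumr.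
  rewrite big1 ?ltxx// => i _.
  by rewrite linearZr/= wO ?mulr0// mem_nth.
rewrite /orthonormal/= s1 sO !andbT; apply/andP; split.
  rewrite linearZl_LR linearZr/= mulrA -expr2 exprVn sqr_sqrtr ?ltW//.
  by rewrite mulVf// lt0r_neq0.
by apply/allP => u us /=; rewrite linearZl_LR/= wO// mulr0.
Qed.

Lemma exists_orthonormal_basis : exists e : (\dim {:H}).-tuple H,
  basis_of fullv e && orthonormal (hdot H) e.
Proof.
have step k : (k <= \dim {:H})%N ->
    exists2 s : seq H, size s = k & free s && orthonormal (hdot H) s.
  elim: k => [_|k IH kH]; first by exists [::] => //; rewrite nil_free.
  have [s sk sO] := IH (ltnW kH).
  have [v vO] : exists v, free (v :: s) && orthonormal (hdot H) (v :: s).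
    by apply: orthonormal_extend => //; rewrite sk.
  by exists (v :: s) => //=; rewrite sk.
have [s /eqP sk /andP[frs sO]] := step _ (leqnn _).
by exists (Tuple sk); rewrite sO basisEfree frs subvf/= (eqP sk) leqnn.
Qed.

(* The notions below transport Borel measurability and Lebesgue measure on R^d
   to H along the isometry given by a chosen orthonormal basis; they do not
   depend on the choice, by orthogonal invariance of Lebesgue measure. *)
Definition onb : (\dim {:H}).-tuple H := sval (cid exists_orthonormal_basis).

Definition of_coord (t : (\dim {:H}).-tuple (measurableTypeR R)) : H :=
  \sum_(i < \dim {:H}) (tnth t i : R) *: tnth onb i.

Local Notation mu := (lebesgue_tuple R (\dim {:H})).

Definition hmeasurable (f : H -> \bar R) : Prop :=
  measurable_fun [set: (\dim {:H}).-tuple (measurableTypeR R)]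
    (fun t => f (of_coord t)).
Definition hintegral (f : H -> \bar R) : \bar R := (\int[mu]_t f (of_coord t))%E.
Definition hLnorm (p : \bar R) (f : H -> \bar R) : \bar R :=
  'N[mu]_p[f \o of_coord]%E.

Definition posdef (A : 'End(H)) : Prop :=
  (forall x y, <[A x, y]> = <[x, A y]>) /\
  (forall x, x != 0 -> 0 < <[A x, x]>).

End fdHilbert_theory.

(* Source and target vertices are separate families, and [bl_arrow i j] is the
   finite set A_ij, so that the quiver is bipartite by construction. *)
Record quiverBLdatum (R : realType) := QuiverBLdatum {
  bl_n : nat;
  bl_m : nat;
  bl_src : 'I_bl_n -> fdHilbert R;
  bl_tgt : 'I_bl_m -> fdHilbert R;
  bl_src_neq0 : forall i, (0 < \dim {: bl_src i})%N;
  bl_tgt_neq0 : forall j, (0 < \dim {: bl_tgt j})%N;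
  bl_arrow : 'I_bl_n -> 'I_bl_m -> finType;
  bl_map : forall i j, bl_arrow i j -> 'Hom(bl_src i, bl_tgt j);
  bl_map_surj : forall i j (a : bl_arrow i j), limg (bl_map a) = fullv;
  bl_exp : 'I_bl_m -> \bar R;
  bl_exp_ge1 : forall j, 1 <= bl_exp j
}.

Section BLCD.
Context (R : realType) (D : quiverBLdatum R).

Definition bl_alpha (j : 'I_(bl_m D)) : nat :=
  (\sum_(i < bl_n D) #|bl_arrow i j|)%N.

Definition bl_inequality (C : \bar R)
    (f : forall j : 'I_(bl_m D), bl_tgt j -> \bar R) : Prop :=
  \prod_(i < bl_n D) hintegral (fun x : bl_src i =>
     \prod_(j < bl_m D) \prod_(a : bl_arrow i j) f j (bl_map a x))
  <= C * \prod_(j < bl_m D) hLnorm (bl_exp j) (f j) ^+ bl_alpha j.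

Definition bl_gaussian (A : forall j : 'I_(bl_m D), 'End(bl_tgt j))
    (j : 'I_(bl_m D)) (x : bl_tgt j) : \bar R :=
  (expR (- pi * hdot (bl_tgt j) (A j x) x * (bl_alpha j)%:R
           * fine (bl_exp j)^-1%E))%:E.

(* [ereal_inf] is the smallest admissible constant: the infimum is attained,
   also under the convention 0 * +oo = 0. *)
Definition BLCD : \bar R := ereal_inf [set C | 0 <= C /\
  forall f : forall j : 'I_(bl_m D), bl_tgt j -> \bar R,
    (forall j, hmeasurable (f j)) -> (forall j x, 0 <= f j x) ->
    bl_inequality C f].

Definition BLCD_G : \bar R := ereal_inf [set C | 0 <= C /\
  forall A : forall j : 'I_(bl_m D), 'End(bl_tgt j),
    (forall j, posdef (A j)) -> bl_inequality C (bl_gaussian A)].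

End BLCD.

(* Main.v *)
(* Two sources and one target, all equal to the real line, with identity maps on
   one arrow from the first source and three from the second, and exponent 2:
   the inequality is [int f * int f^3 <= C (int f^2)^2]. On Gaussians both sides
   scale alike under dilation, so the best constant is finite. A function with
   two values at different scales escapes this: if f is M on [0, 1) and 1 on
   [1, 1 + M^2), then [int f >= M^2], [int f^3 >= M^3] and [int f^2 = 2 M^2], so
   [C >= M / 4]. *)
From HB Require Import structures.
Require Import Defs.
From mathcomp Require Import all_boot all_order all_algebra.
From mathcomp Require Import all_classical all_reals all_analysis.
From mathcomp Require Import measurable_realfun sesquilinear ring lra.

Import Order.TTheory GRing.Theory Num.Theory.
Import numFieldNormedType.Exports.

Local Open Scope ring_scope.
Local Open Scope classical_set_scope.
Local Open Scope ereal_scope.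

(** * Integration over a one-dimensional Hilbert space *)

Lemma ge0_integral_lebesgue_tuple1 (R : realType) (d : nat) (i : 'I_d)
    (F : R -> \bar R) : d = 1%N ->
  measurable_fun setT F -> (forall x, 0 <= F x) ->
  \int[lebesgue_tuple R d]_t F (tnth t i) = \int[@lebesgue_measure R]_x F x.
Proof.
(* [d] is a variable because it will be [\dim {:H}], which equals 1 only propositionally. Once it is
   1, Tonelli leaves a Dirac mass at the empty tuple as inner integral. *)
case: d i => [|[|//]] i // _ mF F0; rewrite (ord1 i) /= /lebesgue_cons.
have mFt : measurable_fun setT
    (fun t : 1.-tuple (measurableTypeR R) => F (tnth t ord0)).
  by apply: (measurableT_comp mF); exact: measurable_tnth.
rewrite (ge0_integral_pushforward (@measurable_cons_fun R 0))//.
rewrite preimage_setT fubini_tonelli1//=; last first.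
  by apply: (measurableT_comp mFt); exact: measurable_cons_fun.
apply: eq_integral => x _; rewrite /fubini_F (eq_integral (cst (F x)))//=.
by rewrite integral_dirac// diracT mul1e.
Qed.

Lemma hdotZZ (R : realType) (H : fdHilbert R) (x : R) (u v : H) :
  hdot H (x *: u) (x *: v) = (x ^+ 2 * hdot H u v)%R.
Proof. by rewrite linearZl_LR linearZr/= mulrA expr2. Qed.

Section one_dimensional.
Context {R : realType} (H : fdHilbert R).
Hypothesis H1 : \dim {:H} = 1%N.

(** This must be the basis vector chosen in [onb], since [of_coord] is built on it. Even on [line]
    it is known only up to sign, so later proofs use just its norm. *)
Definition unit_vector : H := tnth (onb H) (cast_ord (esym H1) ord0).

Lemma unit_vector_norm1 : hdot H unit_vector unit_vector = 1%R.
Proof.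
have /andP[_ /andP[/allP/(_ unit_vector) e1 _]] := svalP (cid (exists_orthonormal_basis H)).
by apply/eqP/e1; exact: mem_tnth.
Qed.

Lemma hdot_unit_vector x : hdot H (x *: unit_vector) unit_vector = x.
Proof. by rewrite linearZl_LR/= unit_vector_norm1 mulr1. Qed.

Let of_coordE t :
  of_coord t = (tnth t (cast_ord (esym H1) ord0) : R) *: unit_vector.
Proof.
rewrite /of_coord (bigD1 (cast_ord (esym H1) ord0))//= big1 ?addr0// => i.
by case/eqP; apply: val_inj => /=; have := ltn_ord i; rewrite {2}H1; case: (val i).
Qed.

Context (g : H -> \bar R).
Hypothesis mg : measurable_fun setT (fun x : R => g (x *: unit_vector)).

Lemma hmeasurable_dim1 : hmeasurable g.
Proof.
rewrite /hmeasurable; under eq_fun do rewrite of_coordE.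
by apply: (measurableT_comp mg); exact: measurable_tnth.
Qed.

Hypothesis g0 : forall u, 0 <= g u.

Lemma hintegral_dim1 :
  hintegral g = \int[@lebesgue_measure R]_x g (x *: unit_vector).
Proof.
rewrite /hintegral; under eq_integral do rewrite of_coordE.
by rewrite (@ge0_integral_lebesgue_tuple1 _ _ _ (fun x => g (x *: unit_vector))).
Qed.

End one_dimensional.

(** Squaring cancels the root in the norm; real and natural powers with exponent 2 agree on
    nonnegative values, also at [+oo]. *)
Lemma hLnorm2_dim1 (R : realType) (H : fdHilbert R) (H1 : \dim {:H} = 1%N)
    (g : H -> \bar R) :
  measurable_fun setT (fun x : R => g (x *: unit_vector H H1)) ->
  (forall u, 0 <= g u) ->
  hLnorm 2%:E g ^+ 2 = \int[@lebesgue_measure R]_x g (x *: unit_vector H H1) ^+ 2.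
Proof.
move=> mg g0.
have p2 (x : \bar R) : 0 <= x -> x `^ 2 = x ^+ 2.
  case: x => [r| |]// r0; first by rewrite poweR_EFin powR_mulrn// EFin_expe.
  by rewrite poweRyr.
rewrite -p2 ?Lnorm_ge0// poweR_Lnorm//.
rewrite -(@hintegral_dim1 _ _ H1 (fun u => g u ^+ 2)) /hintegral//.
- by apply: eq_integral => t _ /=; rewrite gee0_abs// p2.
- under eq_fun do rewrite expe2; exact: emeasurable_funM.
- by move=> u; rewrite expe_ge0.
Qed.

(** * The datum and its inequality on the real line *)

Section datum.
Variable R : realType.

Definition line_dot (u v : R^o) : R := (u * v)%R.

Lemma line_dot_bilinear : bilinear_for
  (GRing.Scale.Law.clone _ _ ( *%R ) _)
  (GRing.Scale.Law.clone _ _ (idfun \; *%R)%FUN _) line_dot.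
Proof. by split=> u a x y; rewrite /line_dot /= /GRing.scale/=; ring. Qed.

HB.instance Definition _ := bilinear_isBilinear.Build R R^o R^o R _ _ line_dot
  line_dot_bilinear.

Lemma line_dot_hermitian u v :
  line_dot u v = ((-1) ^+ false * idfun (line_dot v u))%R.
Proof. by rewrite /= expr0 mul1r /line_dot mulrC. Qed.

HB.instance Definition _ := isHermitianSesquilinear.Build R R^o false idfun
  line_dot line_dot_hermitian.

Lemma line_dot_gt0 u : u != 0%R -> (0 < line_dot u u)%R.
Proof. by move=> u0; rewrite /line_dot -expr2 exprn_even_gt0. Qed.

HB.instance Definition _ := isDotProduct.Build R R^o line_dot line_dot_gt0.

Definition line : fdHilbert R := @FdHilbert R R^o line_dot.

Lemma dim_line : \dim {: line} = 1%N.
Proof. by rewrite dimvf /dim. Qed.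

Lemma dim_line_gt0 : (0 < \dim {: line})%N. Proof. by rewrite dim_line. Qed.

(** The arrow type ['I_(i.*2).+1] has one element for i = 0 and three for i = 1, without a case
    distinction on the source. *)
Definition datum : quiverBLdatum R :=
  @QuiverBLdatum R 2 1 (fun=> line) (fun=> line)
    (fun=> dim_line_gt0) (fun=> dim_line_gt0)
    (fun i _ => 'I_(i.*2).+1) (fun _ _ _ => \1%VF)
    (fun _ _ _ => lim1g fullv) (fun=> 2%:E) (fun=> ltac:(by rewrite lee_fin ler1n)).

Local Notation leb := (@lebesgue_measure R).
Local Notation e := (unit_vector line dim_line).

Lemma bl_alpha_datum j : @bl_alpha _ datum j = 4%N.
Proof. by rewrite /bl_alpha !big_ord_recl big_ord0 /= !card_ord. Qed.

Lemma datum_inequalityE (C : \bar R)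
    (f : forall j : 'I_(bl_m datum), @bl_tgt _ datum j -> \bar R) :
  measurable_fun setT (fun x : R => f ord0 (x *: e : line)) ->
  (forall j x, 0 <= f j x) ->
  bl_inequality C f =
  ((\int[leb]_x f ord0 (x *: e : line)) * (\int[leb]_x f ord0 (x *: e : line) ^+ 3)
    <= C * (\int[leb]_x f ord0 (x *: e : line) ^+ 2) ^+ 2).
Proof.
move=> mf f0; rewrite /bl_inequality big_ord_recl big_ord1 big_ord1.
have f1 (u : line) : \prod_(j < bl_m datum) \prod_(a : @bl_arrow _ datum ord0 j)
    f j (bl_map a u) = f ord0 u.
  by rewrite big_ord1 big_ord1 lfunE.
have f3 (u : line) :
    \prod_(j < bl_m datum) \prod_(a : @bl_arrow _ datum (lift ord0 ord0) j)
      f j (bl_map a u) = f ord0 u ^+ 3.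
  by rewrite big_ord1 /= !big_ord_recl big_ord0 /= !lfunE/= mule1.
rewrite bl_alpha_datum (funext f1) (funext f3).
(* The fourth power is split as a square of a square to expose the form in [hLnorm2_dim1]. *)
rewrite (_ : hLnorm _ _ ^+ 4 = (hLnorm 2%:E (f ord0) ^+ 2) ^+ 2); last first.
  by rewrite !expe2 !expeS expe0 mule1 !muleA.
rewrite (@hLnorm2_dim1 _ _ dim_line (f ord0))// !(@hintegral_dim1 _ _ dim_line)//.
  by under eq_fun do rewrite !expeS expe0 mule1; do !apply: emeasurable_funM.
by move=> u; rewrite expe_ge0.
Qed.

(** * No finite constant serves all functions *)

Definition step (M x : R) : R :=
  (M * \1_`[0%R, 1%R[ x + \1_`[1%R, 1 + M ^+ 2[ x)%R.

(** The two intervals are disjoint, so powers act on each value separately. The exponent is positive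
    because a zeroth power would be 1 off the support too. *)
Lemma step_expr M k x : (step M x ^+ k.+1)%R =
  (M ^+ k.+1 * \1_`[0%R, 1%R[ x + \1_`[1%R, 1 + M ^+ 2[ x)%R.
Proof.
rewrite /step !indicE !mem_setE !in_itv/=; have [x1|x1] := ltP x 1%R.
  by rewrite !andbT !addr0 exprMn; case: (0 <= x)%R; rewrite ?expr1n ?expr0n.
by rewrite andbF !mulr0 !add0r; case: (x < _)%R; rewrite ?expr1n ?expr0n.
Qed.

Lemma integral_step_expr M k : (0 < M)%R ->
  \int[leb]_x (step M x ^+ k.+1)%:E = (M ^+ k.+1 + M ^+ 2)%:E.
Proof.
move=> /[dup] /ltW M0 Mgt0; under eq_integral do rewrite step_expr EFinD EFinM.
rewrite ge0_integralD//=; last 3 first.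
- by move=> x _; rewrite -EFinM lee_fin mulr_ge0// exprn_ge0.
- by apply/measurable_EFinP; apply: measurable_funM => //; exact: measurable_indic.
- by apply/measurable_EFinP; exact: measurable_indic.
rewrite ge0_integralZl_EFin//= ?exprn_ge0//; last first.
  by apply/measurable_EFinP; exact: measurable_indic.
rewrite !integral_indic//= !setIT !lebesgue_measure_itv/= !lte_fin ltr01 oppr0 adde0 mule1.
by rewrite ltrDl exprn_gt0// -!EFinD; congr EFin; ring.
Qed.

Lemma BLCD_datum : BLCD datum = +oo.
Proof.
apply/eqP; rewrite -leye_eq; apply/ereal_infP => -[r| |]//; last by case.
(* An admissible constant is at least M / 4, and this M makes M / 4 exceed r. *)
move=> -[]; rewrite lee_fin => r0; set M := (4 * r + 1)%R => Cf.
have M0 : (0 < M)%R by rewrite /M; lra.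
(* The inner product with [e] reads off the coordinate whatever the sign of [e]. *)
pose f (j : 'I_(bl_m datum)) (v : line) : \bar R := (step M (hdot line v e))%:E.
have fE x : f ord0 (x *: e) = (step M x)%:E by rewrite /f hdot_unit_vector.
have step_ge0 x : (0 <= step M x)%R by rewrite addr_ge0// mulr_ge0// ltW.
have mf : measurable_fun setT (fun x : R => f ord0 (x *: e)).
  under eq_fun do rewrite fE; apply/measurable_EFinP.
  by apply: measurable_funD; [apply: measurable_funM|]; rewrite ?measurable_indic//.
have f0 j v : 0 <= f j v by rewrite lee_fin.
have := Cf f; rewrite datum_inequalityE// => /(_ _ f0).
have mfj j : hmeasurable (f j).
  exact: (hmeasurable_dim1 _ dim_line).
move=> /(_ mfj).
under eq_integral do rewrite fE.
under [X in _ * X]eq_integral do rewrite fE -EFin_expe.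
under [X in X ^+ 2]eq_integral do rewrite fE -EFin_expe.
rewrite (integral_step_expr M 0)// !integral_step_expr// -EFin_expe -!EFinM lee_fin.
(* Without r the inequality reads (M + M^2)(M^3 + M^2) <= (M - 1) M^4, that is, 3 M^4 + M^3 <= 0. *)
have -> : (r = (M - 1) / 4)%R by rewrite /M; field.
move=> ineq; exfalso; move: ineq; apply/negP; rewrite -ltNge.
have := exprn_gt0 3 M0; have := exprn_gt0 4 M0; have := exprn_gt0 5 M0.
by clearbody M; nra.
Qed.

(** * A finite constant serves all Gaussians *)

Lemma integral_gaussian (a : R) : (0 < a)%R ->
  \int[leb]_x (expR (- (a * x ^+ 2)))%:E = (Num.sqrt (pi / a))%:E.
Proof.
(* With variance 1 / (2a), the centred normal density is the integrand times its peak value, and its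
   total mass is 1. *)
move=> a0; pose s := Num.sqrt (2 * a)^-1.
have s2 : (s ^+ 2 = (2 * a)^-1)%R by rewrite sqr_sqrtr// invr_ge0; lra.
have s0 : s != 0%R by rewrite sqrtr_eq0 -ltNge invr_gt0; lra.
have peak : (normal_peak s)^-1%R = Num.sqrt (pi / a).
  rewrite /normal_peak invrK; congr Num.sqrt.
  by rewrite s2; field; lra.
have pi0 := pi_gt0 R.
have peak0 : normal_peak s != 0%R by rewrite gt_eqF ?normal_peak_gt0.
under eq_integral => x _.
  rewrite (_ : expR _ = (normal_peak s)^-1 * normal_pdf 0 s x)%R; last first.
    rewrite normal_pdfE// mulKf// /normal_fun; congr expR.
    by rewrite s2 subr0; field; lra.
  rewrite EFinM; over.
rewrite ge0_integralZl_EFin//= ?invr_ge0 ?normal_peak_ge0//.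
- by rewrite integral_normal_pdf mule1 peak.
- by move=> x _; rewrite lee_fin normal_pdf_ge0.
- by apply/measurable_EFinP; exact: measurable_normal_pdf.
Qed.

(** For exp(- a x^2) the left side is sqrt(pi / a) sqrt(pi / (3a)) and the squared integral on the
    right is pi / (2a). The ratio 2 / sqrt 3 is the same for all a; dropping the 3 gives the simpler
    bound 2. *)
Lemma BLCD_G_datum : BLCD_G datum <= 2%:E.
Proof.
apply: ereal_inf_lbound; split=> // A A0.
pose c := hdot line (A ord0 e) e.
have e0 : e != 0%R.
  apply/eqP => e0; have := unit_vector_norm1 line dim_line.
  by rewrite e0 linear0l => /esym/eqP; rewrite oner_eq0.
have c0 : (0 < c)%R by exact: (A0 ord0).2.
have pi0 := pi_gt0 R.
(* The factor 2 is [bl_alpha] over the exponent, 4 / 2. *)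
pose a := (2 * pi * c)%R.
have a0 : (0 < a)%R by apply: mulr_gt0 => //; exact: mulr_gt0.
have gE x : @bl_gaussian _ datum A ord0 (x *: e : line) = (expR (- (a * x ^+ 2)))%:E.
  rewrite /bl_gaussian bl_alpha_datum; congr (expR _)%:E.
  have -> : hdot line (A ord0 (x *: e)) (x *: e) = (x ^+ 2 * c)%R.
    by rewrite [A ord0 _]linearZ; exact: hdotZZ.
  rewrite inver pnatr_eq0/=.
  by rewrite /a; field.
clearbody a; have gX x k : (expR (- (a * x ^+ 2)))%:E ^+ k =
    (expR (- (k%:R * a * x ^+ 2)))%:E.
  by rewrite -EFin_expe -expRM_natl mulrN !mulrA.
have mg : measurable_fun setT (fun x : R => @bl_gaussian _ datum A ord0 (x *: e)).
  under eq_fun do rewrite gE; apply/measurable_EFinP.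
  apply: measurableT_comp => //; apply: measurableT_comp => //.
  by apply: measurable_funM => //; exact: measurable_funX.
rewrite datum_inequalityE//; last by move=> j x; rewrite lee_fin expR_ge0.
under eq_integral do rewrite gE.
under [X in _ * X]eq_integral do rewrite gE gX.
under [X in X ^+ 2]eq_integral do rewrite gE gX.
rewrite !integral_gaussian ?mulr_gt0// -EFin_expe -!EFinM lee_fin.
have pa0 : (0 <= pi / a)%R by rewrite divr_ge0 ?ltW.
rewrite sqr_sqrtr; last by rewrite invfM mulrCA mulr_ge0.
have -> : (2 * (pi / (2 * a)) = pi / a)%R by field; lra.
rewrite -[leRHS]sqr_sqrtr// expr2 ler_wpM2l ?sqrtr_ge0// ler_wsqrtr//.
by rewrite invfM mulrCA ler_piMl// invf_le1// ler1n.
Qed.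

End datum.

Theorem corollary1p13 (R : realType) :
  exists D : quiverBLdatum R, BLCD_G D < BLCD D /\ BLCD D = +oo.
Proof.
exists (datum R); rewrite BLCD_datum; split=> //.
by rewrite (le_lt_trans (BLCD_G_datum R))// ltry.
Qed.
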